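(* Let $q$ and $r$ be two positive integers and $u_0$ be a non-negative integer. Let $(u_n)_{n \in \mathbb{N}}$ be the sequence of natural numbers whose general term is $u_n = r [n]_q + u_0$. Suppose that $\gcd(u_0, r) = \gcd(u_1, q) = 1$, and set $$B := \max\left(r, \frac{u_0 (q - 1) + 1 - r}{2}\right).$$ Then, for any positive integer $n$, we have $$\mathrm{lcm}\{u_1, u_2, \dots, u_n\} \geq u_1 \left(\frac{r + 1}{2 \sqrt{B}}\right)^{n - 1} q^{\frac{(n - 1)(n - 4)}{4}}.$$
   Context: $\mathbb{N}$ is the set of non-negative integers. For $n \in \mathbb{N}$, $[n]_q := \frac{q^n - 1}{q - 1}$ if $q \neq 1$ and $[n]_1 := n$. *)

(* Defs.v *)
From HB Require Import structures.
From mathcomp Require Import all_boot all_order all_algebra.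

Set Implicit Arguments.
Unset Strict Implicit.
Unset Printing Implicit Defensive.

(* The q-integer [n]_q.  For 1 < q the truncated subtractions and the
   Euclidean quotient below are exact, since q - 1 divides q ^ n - 1. *)
Definition qint (q n : nat) : nat :=
  if q == 1 then n else (q ^ n - 1) %/ (q - 1).

(* Main.v *)
(* Since u_i - u_j = r q^j [i-j]_q and the u_i (i >= 1) are coprime to r q, the
   quotient C(n,k) = u_k ... u_n / [n-k]_q! divides lcm(u_k, ..., u_n). With
   m = min([n+1-k]_q, u_k), either C(n+1,k) or C(n+1,k+1) equals
   C(n,k) u_(n+1) / m, so it suffices to see that this ratio is at least
   (r+1) / (2 sqrt B) q^((n-2)/2) and to induct on n. *)
Require Import Defs.
From HB Require Import structures.
From mathcomp Require Import all_boot all_order all_algebra.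
From mathcomp Require Import all_classical all_reals all_analysis.
From mathcomp Require Import zify ring lra.

Set Implicit Arguments.
Unset Strict Implicit.
Unset Printing Implicit Defensive.
Import Order.TTheory GRing.Theory Num.Theory.

Local Open Scope ring_scope.

(** * The q-integers as geometric sums *)

Lemma qintE (q n : nat) : (0 < q)%N -> qint q n = (\sum_(i < n) q ^ i)%N.
Proof.
move=> q_gt0; rewrite /qint; case: eqVneq => [->|q_neq1].
  rewrite (eq_bigr (fun=> 1%N)) => [|i _]; last by rewrite exp1n.
  by rewrite sum1_card card_ord.
by rewrite !subn1 predn_exp mulKn //; lia.
Qed.

Lemma qint0 (q : nat) : (0 < q)%N -> qint q 0 = 0%N.
Proof. by move=> q_gt0; rewrite qintE // big_ord0. Qed.

Lemma qint1 (q : nat) : (0 < q)%N -> qint q 1 = 1%N.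
Proof. by move=> q_gt0; rewrite qintE // big_ord1. Qed.

Lemma qintD (q m n : nat) : (0 < q)%N ->
  qint q (m + n) = (qint q m + q ^ m * qint q n)%N.
Proof.
move=> q_gt0; rewrite !qintE // big_split_ord big_distrr /=; congr addn.
by apply: eq_bigr => i _; rewrite expnD.
Qed.

Lemma qint_gt0 (q n : nat) : (0 < q)%N -> (0 < n)%N -> (0 < qint q n)%N.
Proof. by move=> q_gt0; case: n => // n _; rewrite -[n.+1]add1n qintD // qint1. Qed.

Lemma qint_expn (q n : nat) : (0 < q)%N -> ((q - 1) * qint q n + 1 = q ^ n)%N.
Proof.
move=> q_gt0; rewrite qintE // subn1 -predn_exp.
by rewrite addn1 prednK // expn_gt0 q_gt0.
Qed.

(** * Divisibility properties of the terms u_k *)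

Section QArithmeticProgression.

Variables q r u0 : nat.
Hypothesis q_gt0 : (0 < q)%N.

Let u n := (r * qint q n + u0)%N.

Lemma qprogD k m : u (k + m) = (u k + r * q ^ k * qint q m)%N.
Proof. by rewrite /u qintD //; lia. Qed.

Lemma qprog_gt0 k : (0 < r)%N -> (0 < k)%N -> (0 < u k)%N.
Proof. by move=> r_gt0 k_gt0; rewrite /u addn_gt0 muln_gt0 r_gt0 qint_gt0. Qed.

Lemma qprog_coprime_r k : coprime u0 r -> coprime (u k) r.
Proof. by rewrite /u /coprime !(gcdnC _ r) (mulnC r) gcdnMDl. Qed.

(** From index 1 on, all terms are congruent modulo q, as u_(1+k) = u_1 + r q [k]_q. *)
Lemma qprog_coprime_q k : (0 < k)%N -> coprime (u 1) q -> coprime (u k) q.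
Proof.
case: k => // k _; rewrite -[k.+1]add1n qprogD expn1 -mulnA mulnCA.
by rewrite /coprime !(gcdnC _ q) [(q * _)%N]mulnC [(_ + _ * q)%N]addnC gcdnMDl.
Qed.

(* Both [L [m]! u_k] and [L [m]! u_(k+m+1)] are divisible by the product
   [u_k ... u_(k+m+1)], hence so is their difference [L [m+1]! r q^k], and
   [r q^k] is coprime to the product. *)
Lemma prod_qprog_dvd (L k m : nat) :
  coprime u0 r -> coprime (u 1) q -> (0 < k)%N ->
  (forall i, (k <= i <= k + m)%N -> u i %| L)%N ->
  ((\prod_(k <= i < (k + m).+1) u i) %| L * \prod_(j < m) qint q j.+1)%N.
Proof.
move=> cop_r cop_q; elim: m k => [|m IHm] k k_gt0 dvL.
  by rewrite addn0 big_nat1 big_ord0 muln1 dvL // addn0 leqnn.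
have dv_low : ((\prod_(k <= i < (k + m).+1) u i) %|
    L * \prod_(j < m) qint q j.+1)%N by apply: IHm => // i ?; apply: dvL; lia.
have dv_high : ((\prod_(k.+1 <= i < (k.+1 + m).+1) u i) %|
    L * \prod_(j < m) qint q j.+1)%N by apply: IHm => // i ?; apply: dvL; lia.
set F := (\prod_(j < m) _)%N in dv_low dv_high *.
set M := (\prod_(_ <= i < _) _)%N.
have dvM1 : (M %| L * F * u (k + m.+1))%N.
  by rewrite /M addnS big_nat_recr ?dvdn_mul //=; lia.
have dvM2 : (M %| L * F * u k)%N.
  rewrite /M big_ltn; last by lia.
  by rewrite mulnC dvdn_mul // addnS -addSn.
have copM : coprime M (r * q ^ k).
  rewrite /M big_nat; elim/big_ind: _ => [|x y cx cy|i /andP[k_le_i _]].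
  - exact: coprime1n.
  - by rewrite coprimeMl cx.
  - rewrite coprimeMr qprog_coprime_r // coprimeXr //.
    by rewrite qprog_coprime_q //; apply: leq_trans k_le_i.
rewrite big_ord_recr /= -/F -(Gauss_dvdr _ copM).
suff -> : (r * q ^ k * (L * (F * qint q m.+1)) =
  L * F * u (k + m.+1) - L * F * u k)%N by rewrite dvdn_sub.
by rewrite qprogD mulnDr addKn [RHS]mulnCA !mulnA.
Qed.

End QArithmeticProgression.

Lemma dvdn_biglcm_nat (F : nat -> nat) m n i : (m <= i < n)%N ->
  (F i %| \big[lcmn/1%N]_(m <= k < n) F k)%N.
Proof.
move=> i_mn; rewrite (big_rem i) ?mem_index_iota //=; exact: dvdn_lcml.
Qed.

Lemma biglcm_nat_gt0 (F : nat -> nat) m n :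
  (forall i, (m <= i < n)%N -> 0 < F i)%N ->
  (0 < \big[lcmn/1%N]_(m <= k < n) F k)%N.
Proof.
move=> F_gt0; rewrite big_nat; elim/big_ind: _ => // x y x0 y0.
by rewrite lcmn_gt0 x0.
Qed.

(** * Lower bounds for the quotients C(n,k) *)

Section Growth.

Variable R : realType.
Variables q r u0 : nat.
Hypotheses (q_gt0 : (0 < q)%N) (r_gt0 : (0 < r)%N).

Let u n := (r * qint q n + u0)%N.

(** The maximum in the theorem is the least [B] with the two properties below. *)
Variable B : R.
Hypotheses (B_r : r%:R <= B) (B_u0 : u0%:R * (q%:R - 1) + 1 - r%:R <= 2 * B).

(* Put [m = min([a]_q, u_k)]. The two estimates [(1 + r q^k) m <= u_(k+a)] and
   [r q^(k+a) u_k <= (r q^k + 2 B - 1) u_(k+a)] are multiplied together. *)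
Lemma sqr_min_le (k a : nat) (m : R) : (0 < k)%N -> 0 <= m ->
  m <= (qint q a)%:R -> m <= (u k)%:R ->
  (r%:R + 1) ^+ 2 * q%:R ^+ (k + a) * m ^+ 2 <=
    4 * B * q%:R ^+ 3 * (u (k + a))%:R ^+ 2.
Proof.
move=> k_gt0 m_ge0 m_le_a m_le_b.
have r1 : 1 <= r%:R :> R by rewrite ler1n.
have B1 : 1 <= B by apply: le_trans B_r.
have q1 : 1 <= q%:R :> R by rewrite ler1n.
have Q1 : 1 <= q%:R ^+ k :> R by rewrite exprn_ege1.
have P1 : 1 <= q%:R ^+ a :> R by rewrite exprn_ege1.
have uE : (u (k + a))%:R = (u k)%:R + r%:R * q%:R ^+ k * (qint q a)%:R :> R.
  by rewrite /u qprogD // natrD !natrM natrX.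
have u_lb : (1 + r%:R * q%:R ^+ k) * m <= (u (k + a))%:R.
  rewrite uE mulrDl mul1r lerD // ler_wpM2l // mulr_ge0 //; lra.
have geom n : (q%:R - 1) * (qint q n)%:R + 1 = q%:R ^+ n :> R.
  by rewrite -natrX -(qint_expn n q_gt0) natrD natrM natrB.
have uq n : (q%:R - 1) * (u n)%:R =
    r%:R * q%:R ^+ n + (u0%:R * (q%:R - 1) - r%:R) :> R.
  by rewrite /u -geom natrD natrM; ring.
have uq1 := uq k; have uq2 := uq (k + a)%N.
rewrite exprD in uq2 *.
(* The general argument cancels q - 1, so q = 1 is treated apart: there [u_lb] squared suffices,
   since 4 B >= 1. *)
have [q_le1|q_gt1] := leqP q 1.
  have q_eq1 : q = 1%N by apply/eqP; rewrite eqn_leq q_le1.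
  move: u_lb; rewrite q_eq1 !expr1n !mulr1 => u_lb.
  have : ((1 + r%:R) * m) ^+ 2 <= (u (k + a))%:R ^+ 2 :> R.
    by rewrite lerXn2r // nnegrE ?ler0n // mulr_ge0 //; lra.
  have : 0 <= (u (k + a))%:R ^+ 2 :> R by rewrite sqr_ge0.
  rewrite exprMn; nra.
have q2 : 2 <= q%:R :> R by rewrite ler_nat.
have q3 : 2 <= q%:R ^+ 3 :> R.
  by rewrite -natrX ler_nat (leq_trans q_gt1) // -{1}(expn1 q) leq_exp2l.
have v_ge0 : 0 <= (u (k + a))%:R :> R by exact: ler0n.
have b_ge0 : 0 <= (u k)%:R :> R by exact: ler0n.
move: {uq uE geom} uq1 uq2 u_lb v_ge0 b_ge0 q3 B_u0 B_r P1 Q1 m_le_b.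
move: (u (k + a))%:R (u k)%:R (q%:R ^+ 3) (q%:R ^+ k) (q%:R ^+ a).
move=> v b q3 Q P.
(* Now v = u_(k+a), b = u_k, Q = q^k, P = q^a, and (q - 1) u_n = r q^n + S for n = k and n = k +
   a. *)
set S := u0%:R * _ - r%:R => uq1 uq2 u_lb v_ge0 b_ge0 q3_2 BS BR P1 Q1 m_b.
have {}BS : S + 1 <= 2 * B by rewrite /S; lra.
have rQ : 1 <= r%:R * Q by nra.
have W0 : 0 < r%:R * Q + 2 * B - 1 by lra.
have qb0 : 0 <= r%:R * Q + S by rewrite -uq1 mulr_ge0 //; lra.
have qv0 : 0 <= r%:R * (Q * P) + S by rewrite -uq2 mulr_ge0 //; lra.
have key : r%:R * (Q * P) * b <= (r%:R * Q + 2 * B - 1) * v.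
  have q10 : 0 < q%:R - 1 :> R by lra.
  rewrite -(ler_pM2l q10).
  have -> : (q%:R - 1) * (r%:R * (Q * P) * b) = r%:R * (Q * P) * ((q%:R - 1) * b)
    by ring.
  have -> : (q%:R - 1) * ((r%:R * Q + 2 * B - 1) * v) =
     (r%:R * Q + 2 * B - 1) * ((q%:R - 1) * v) by ring.
  rewrite uq1 uq2 -subr_ge0.
  (* The difference of the two sides is r Q P (2 B - 1 - S) + S (r Q + 2 B - 1), and also (2 B - 1)
     (r Q P + S) - S r Q (P - 1). The sign of S decides which form has nonnegative summands. *)
  have [S0|/ltW S0] := leP 0 S.
    have h1 : 0 <= (r%:R * (Q * P)) * (2 * B - 1 - S) by apply: mulr_ge0; nra.
    have h2 : 0 <= S * (r%:R * Q + (2 * B - 1)) by apply: mulr_ge0; lra.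
    lra.
  have h1 : 0 <= (2 * B - 1) * (r%:R * (Q * P) + S) by apply: mulr_ge0; lra.
  have h2 : 0 <= - S * ((r%:R * Q) * (P - 1)).
    by apply: mulr_ge0; [lra|apply: mulr_ge0; lra].
  lra.
(* The parts with r Q and with 2 B - 1 are each at most 4 B r (1 + r Q); the bound 2 <= q^3 pays for
   both. *)
have coef : (r%:R + 1) ^+ 2 * (r%:R * Q + 2 * B - 1) <=
    4 * B * q3 * (r%:R * (1 + r%:R * Q)).
  have h1 : (r%:R + 1) ^+ 2 * (r%:R * Q) <= 4 * B * r%:R * (r%:R * Q).
    by apply: ler_wpM2r; nra.
  have h2 : (r%:R + 1) ^+ 2 * (2 * B - 1) <= 4 * B * r%:R * (1 + r%:R * Q).
    have h3 : (r%:R + 1) ^+ 2 <= 2 * r%:R * (1 + r%:R * Q) by nra.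
    have h4 : (r%:R + 1) ^+ 2 * (2 * B - 1) <= (r%:R + 1) ^+ 2 * (2 * B).
      by rewrite ler_wpM2l ?sqr_ge0 //; lra.
    apply: (le_trans h4).
    have -> : 4 * B * r%:R * (1 + r%:R * Q) =
      2 * r%:R * (1 + r%:R * Q) * (2 * B) by ring.
    by rewrite ler_wpM2r //; lra.
  have h5 : 2 * (4 * B * (r%:R * (1 + r%:R * Q))) <=
      q3 * (4 * B * (r%:R * (1 + r%:R * Q))).
    by rewrite ler_wpM2r // mulr_ge0 ?mulr_ge0 //; lra.
  have h6 : 0 <= 4 * B * r%:R by rewrite !mulr_ge0 //; lra.
  lra.
have prod_lb : r%:R * (Q * P) * (1 + r%:R * Q) * m ^+ 2 <=
    (r%:R * Q + 2 * B - 1) * v ^+ 2.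
  have QP0 : 0 <= r%:R * (Q * P) by rewrite !mulr_ge0 //; lra.
  have h1 : r%:R * (Q * P) * m <= (r%:R * Q + 2 * B - 1) * v.
    by apply: le_trans key; rewrite ler_wpM2l.
  have -> : r%:R * (Q * P) * (1 + r%:R * Q) * m ^+ 2 =
    (r%:R * (Q * P) * m) * ((1 + r%:R * Q) * m) by ring.
  by rewrite [v ^+ 2]expr2 [leRHS]mulrA ler_pM // mulr_ge0 //; lra.
(* Multiplying by r Q + 2 B - 1 lets [coef] and [prod_lb] be chained through 4 B q^3 r Q P (1 + r Q)
   m^2. *)
rewrite -(ler_pM2l W0).
have QPm : 0 <= Q * P * m ^+ 2.
  by rewrite mulr_ge0 ?sqr_ge0 // mulr_ge0 //; lra.
have s1 := ler_wpM2r QPm coef.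
have s2 : 4 * B * q3 * (r%:R * (Q * P) * (1 + r%:R * Q) * m ^+ 2) <=
    4 * B * q3 * ((r%:R * Q + 2 * B - 1) * v ^+ 2).
  by rewrite ler_wpM2l // !mulr_ge0 //; lra.
lra.
Qed.

(** The square root of the previous estimate: q^(k+a) / q^3 yields the exponent (k + a - 3) / 2. *)
Lemma min_le_qprog (k a : nat) (m : R) : (0 < k)%N -> (0 < a)%N -> 0 <= m ->
  m <= (qint q a)%:R -> m <= (u k)%:R ->
  (r%:R + 1) / (2 * Num.sqrt B) * q%:R `^ (((k + a)%:R - 3) / 2) * m <=
    (u (k + a))%:R.
Proof.
move=> k_gt0 a_gt0 m_ge0 m_a m_b.
have r1 : 1 <= r%:R :> R by rewrite ler1n.
have B0 : 0 < B by apply: lt_le_trans B_r; rewrite ltr0n.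
have sB0 : 0 < Num.sqrt B by rewrite sqrtr_gt0.
have q0 : 0 < q%:R :> R by rewrite ltr0n.
have c0 : 0 <= (r%:R + 1) / (2 * Num.sqrt B) by rewrite divr_ge0 ?mulr_ge0 //; lra.
rewrite -(@ler_pXn2r _ 2) // ?nnegrE ?ler0n ?mulr_ge0 ?powR_ge0 //.
have := sqr_min_le k_gt0 m_ge0 m_a m_b.
have -> : (r%:R + 1) ^+ 2 * q%:R ^+ (k + a) * m ^+ 2 = 4 * B * q%:R ^+ 3 *
  ((r%:R + 1) / (2 * Num.sqrt B) * q%:R `^ (((k + a)%:R - 3) / 2) * m) ^+ 2.
  have -> : q%:R ^+ (k + a) = q%:R ^+ 3 * (q%:R `^ (((k + a)%:R - 3) / 2)) ^+ 2 :> R.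
    rewrite -!powR_mulrn ?powR_ge0 ?(ltW q0) // -powRrM -powRD.
      by congr (_ `^ _); field.
    by rewrite (gt_eqF q0) implybT.
  rewrite !exprMn exprVn exprMn sqr_sqrtr ?(ltW B0) //.
  by field; rewrite gt_eqF.
by rewrite ler_pM2l // !mulr_gt0 // exprn_gt0.
Qed.

(** The lower bound for C(n+1,k), with the denominator [n+1-k]_q! cleared; the index k is built
    along the induction. *)
Lemma prod_qprog_ge n : exists2 k, (0 < k <= n.+1)%N &
  (u 1%N)%:R * ((r%:R + 1) / (2 * Num.sqrt B)) ^+ n
    * q%:R `^ ((n.+1%:R - 1) * (n.+1%:R - 4) / 4) *
    (\prod_(j < n.+1 - k) qint q j.+1)%:R <=
  (\prod_(k <= i < n.+2) u i)%:R :> R.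
Proof.
elim: n => [|n [k /andP[k_gt0 k_le] IHn]].
  exists 1%N => //; rewrite subnn big_ord0 big_nat1 expr0 subrr !mul0r powRr0.
  by rewrite !mulr1.
set c := (r%:R + 1) / (2 * Num.sqrt B) in IHn *.
pose a := (n.+2 - k)%N; have kaE : (k + a)%N = n.+2 by rewrite /a; lia.
have a_gt0 : (0 < a)%N by rewrite /a; lia.
pose f := c * q%:R `^ ((n.+2%:R - 3) / 2).
have q0 : 0 < q%:R :> R by rewrite ltr0n.
have c0 : 0 <= c by rewrite divr_ge0 ?mulr_ge0 ?sqrtr_ge0 // addr_ge0.
have f0 : 0 <= f by rewrite mulr_ge0 ?powR_ge0.
(* The target grows exactly by [f]: its exponent of q rises from n (n - 3) / 4 to (n + 1) (n - 2) /
   4, that is by (n - 1) / 2. *)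
have -> : (u 1%N)%:R * c ^+ n.+1 * q%:R `^ ((n.+2%:R - 1) * (n.+2%:R - 4) / 4) =
  (u 1%N)%:R * c ^+ n * q%:R `^ ((n.+1%:R - 1) * (n.+1%:R - 4) / 4) * f.
  have -> : (n.+2%:R - 1) * (n.+2%:R - 4) / 4 =
    (n.+1%:R - 1) * (n.+1%:R - 4) / 4 + (n.+2%:R - 3) / 2 :> R.
    by rewrite -[n.+2]addn1 -[n.+1]addn1 !natrD; field.
  rewrite powRD; last by rewrite (gt_eqF q0) implybT.
  by rewrite /f exprSr; ring.
set g := (_ * _ ^+ n * _) in IHn *.
have subE : (n.+1 - k)%N = a.-1 by rewrite /a; lia.
have g0 : 0 <= g by rewrite !mulr_ge0 ?exprn_ge0 ?powR_ge0.
rewrite subE in IHn.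
have [ab|/ltnW ba] := leqP (qint q a) (u k).
  (* Keeping k, the numerator gains u_(n+2) and the denominator gains [a]_q, the minimum here. *)
  exists k; first by lia.
  rewrite -/a -(prednK a_gt0) big_ord_recr /= prednK //.
  rewrite big_nat_recr; last by lia.
  rewrite !natrM /=.
  have := @min_le_qprog k a (qint q a)%:R k_gt0 a_gt0.
  rewrite kaE => /(_ (ler0n _ _) (lexx _)); rewrite ler_nat => /(_ ab) fu.
  rewrite -/c -/f in fu.
  rewrite mulrACA.
  by apply: ler_pM => //; apply: mulr_ge0.
(* Passing to k + 1 trades the factor u_k, the minimum here, for u_(n+2) and leaves the denominator
   unchanged. *)
exists k.+1; first by lia.
have := @min_le_qprog k a (u k)%:R k_gt0 a_gt0 (ler0n _ _).
rewrite kaE ler_nat => /(_ ba (lexx _)); rewrite -/c -/f => fu.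
have uk0 : 0 < (u k)%:R :> R by rewrite ltr0n qprog_gt0.
rewrite -(ler_pM2l uk0) -natrM -big_ltn; last by lia.
rewrite big_nat_recr /=; last by lia.
rewrite natrM subSS subE.
have -> : forall x : R, (u k)%:R * (g * f * x) = g * x * (f * (u k)%:R)
  by move=> x; ring.
by apply: ler_pM => //; apply: mulr_ge0.
Qed.

End Growth.

(** * From the quotients to the least common multiple *)

Theorem theorem1p3 (R : realType) (q r u0 : nat) (u : nat -> nat) (B : R)
    (hq : (0 < q)%N) (hr : (0 < r)%N)
    (hu : forall n : nat, u n = (r * qint q n + u0)%N)
    (hgcd0 : gcdn (u 0%N) r = 1%N) (hgcd1 : gcdn (u 1%N) q = 1%N)
    (hB : B = Num.max r%:R ((u0%:R * (q%:R - 1) + 1 - r%:R) / 2))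
    (n : nat) (hn : (0 < n)%N) :
  (\big[lcmn/1%N]_(1 <= k < n.+1) u k)%:R >=
    (u 1%N)%:R * ((r%:R + 1) / (2 * Num.sqrt B)) ^+ (n - 1)
    * q%:R `^ ((n%:R - 1) * (n%:R - 4) / 4) :> R.
Proof.
have {hu} uE : u = fun n => (r * qint q n + u0)%N by apply/funext.
subst u.
have cop_r : coprime u0 r by move: hgcd0; rewrite qint0 // muln0 => /eqP.
have cop_q : coprime (r * qint q 1 + u0) q by apply/eqP.
have B_r : r%:R <= B by rewrite hB le_max lexx.
have B_u0 : u0%:R * (q%:R - 1) + 1 - r%:R <= 2 * B.
  by rewrite [leRHS]mulrC -ler_pdivrMr // hB le_max lexx orbT.
case: n hn => // n _; rewrite subn1 /=.
have [k /andP[k_gt0 k_le] bound] := prod_qprog_ge hq hr B_r B_u0 n.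
set L := (\big[_/_]_(_ <= _ < _) _)%N.
have L_gt0 : (0 < L)%N.
  by apply: biglcm_nat_gt0 => i /andP[i_gt0 _]; apply: qprog_gt0.
have F_gt0 : (0 < \prod_(j < n.+1 - k) qint q j.+1)%N.
  by apply: prodn_gt0 => j; apply: qint_gt0.
have kE : (k + (n.+1 - k))%N = n.+1 by lia.
have := @prod_qprog_dvd q r u0 hq L k (n.+1 - k) cop_r cop_q k_gt0.
rewrite kE => dvd.
have /dvd/dvdn_leq : forall i, (k <= i <= n.+1)%N -> (r * qint q i + u0 %| L)%N.
  move=> i i_kn; apply: (@dvdn_biglcm_nat (fun i => r * qint q i + u0)%N); lia.
(* Divisibility gives u_k ... u_(n+1) <= L [n+1-k]_q!; the q-factorial then cancels against the one
   in [bound]. *)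
rewrite muln_gt0 L_gt0 F_gt0 -(ler_nat R) natrM => /(_ isT) prod_le.
have F0 : 0 < (\prod_(j < n.+1 - k) qint q j.+1)%:R :> R by rewrite ltr0n.
by rewrite -(ler_pM2r F0) (le_trans bound prod_le).
Qed.
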